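(* (a) Every parasemifield that is finitely generated as a semiring is additively idempotent. (b) Every proper semifield that is finitely generated as a semiring is either additively constant or additively idempotent. (c) Every proper finitely generated ideal-simple semiring is either additively constant or additively idempotent.
   Context: All structures are commutative. A semiring is a non-empty set $S$ with two associative and commutative binary operations, addition and multiplication, such that multiplication distributes over addition (no neutral elements are required). A semiring $S$ is a semifield if it contains a zero element $0$ (a multiplicatively absorbing element: $0\cdot a=0$ for all $a\in S$; it is not required to be additively neutral) and $S\setminus\{0\}$ is a group with respect to multiplication. If the entire multiplicative part $S(\cdot)$ is a group, $S$ is called a parasemifield. A semiring (or semifield) is proper if it is not a ring (rings are not required to have a unity). A semiring $S$ is additively idempotent if $x+x=x$ for all $x\in S$, and additively constant if the map $S\times S\to S$, $(x,y)\mapsto x+y$ is constant. A semiring is finitely generated (as a semiring) if it has a finite subset such that the smallest subsemiring containing it is the whole semiring. An ideal of a semiring $S$ is a non-empty subset $I$ with $I+I\subseteq I$ and $S\cdot I\subseteq I$. A semiring $S$ is ideal-simple if it has at least two elements and has no proper ideals, i.e., every ideal of $S$ with at least two elements equals $S$. *)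

(* Defs.v *)
From mathcomp Require Import all_boot.
From mathcomp Require Import mathcomp_extra boolp classical_sets functions cardinality.

Set Implicit Arguments.
Unset Strict Implicit.
Unset Printing Implicit Defensive.

Local Open Scope classical_set_scope.

(* Neither operation is assumed to have a neutral element, so none of the
   semiring structures of MathComp applies. *)
Record semiring : Type := Semiring {
  sort :> Type;
  sadd : sort -> sort -> sort;
  smul : sort -> sort -> sort;
  semiring_inhabited : inhabited sort;
  saddA : associative sadd;
  saddC : commutative sadd;
  smulA : associative smul;
  smulC : commutative smul;
  smulDl : left_distributive smul sadd;
  smulDr : right_distributive smul sadd
}.

Declare Scope semiring_scope.
Delimit Scope semiring_scope with SR.
Notation "x + y" := (sadd x y) : semiring_scope.
Notation "x * y" := (smul x y) : semiring_scope.
Local Open Scope semiring_scope.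

Definition group_on (T : Type) (op : T -> T -> T) (A : set T) : Prop :=
  [/\ forall x y, A x -> A y -> A (op x y),
      forall x y z, A x -> A y -> A z -> op x (op y z) = op (op x y) z &
      exists2 e, A e & forall x, A x ->
        [/\ op e x = x, op x e = x &
            exists2 y, A y & op y x = e /\ op x y = e]].

(* Rings are not required to have a unity. *)
Definition is_ring (S : semiring) : Prop := group_on (@sadd S) setT.

Definition proper (S : semiring) : Prop := ~ is_ring S.

(* A zero is multiplicatively absorbing; it need not be additively neutral. *)
Definition is_zero (S : semiring) (z : S) : Prop := forall a : S, z * a = z.

Definition semifield (S : semiring) : Prop :=
  exists2 z : S, is_zero z & group_on (@smul S) [set~ z].

Definition parasemifield (S : semiring) : Prop := group_on (@smul S) setT.

Definition additively_idempotent (S : semiring) : Prop :=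
  forall x : S, x + x = x.

Definition additively_constant (S : semiring) : Prop :=
  exists c : S, forall x y : S, x + y = c.

Definition subsemiring (S : semiring) (A : set S) : Prop :=
  [/\ A !=set0,
      forall x y, A x -> A y -> A (x + y) &
      forall x y, A x -> A y -> A (x * y)].

Definition finitely_generated (S : semiring) : Prop :=
  exists2 G : set S, finite_set G & smallest (@subsemiring S) G = setT.

Definition ideal (S : semiring) (I : set S) : Prop :=
  [/\ I !=set0,
      forall x y, I x -> I y -> I (x + y) &
      forall s x, I x -> I (s * x)].

Definition ideal_simple (S : semiring) : Prop :=
  (exists x y : S, x <> y) /\
  (forall I : set S, ideal I ->
     (exists x y : S, [/\ I x, I y & x <> y]) -> I = setT).

(* Main.v *)
(* If S contains the positive rationals, let B be the subsemiring of the elements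
   bounded by a positive integer.  Its Grothendieck ring is a rational algebra, and it
   is nonzero unless r + 1 = r for some positive integer r, which forces
   1 + 1 = 1.  Any summand of a bounded element is bounded, so B is spanned by
   monomials x^m with m in a submonoid C of N^n.  Although C need not be finitely
   generated, the exponents m of the monomials that survive in the residue field
   of a maximal ideal generate a subgroup of Z^n, which is finitely generated, so
   the image of B lies in a finitely generated domain of characteristic 0
   containing all 1/N; this is impossible.  Part (b) follows from the same
   argument after a discussion of 1 + 0, and in (c) the ideals aS show that S is a
   parasemifield, a semifield, or has constant multiplication. *)
From HB Require Import structures.
From mathcomp Require Import all_boot all_order all_algebra.
From mathcomp Require Import boolp classical_sets cardinality.
From mathcomp Require Import mpoly ring zify.
Require Import Defs.

Set Implicit Arguments.
Unset Strict Implicit.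
Unset Printing Implicit Defensive.

Import Order.TTheory GRing.Theory Num.Theory.
Local Open Scope classical_set_scope.
Local Open Scope ring_scope.

(** * Dickson's lemma *)

(** Induction on the list of coordinates. A basis for the remaining coordinates serves every element
    whose [i]-th coordinate is at least all those of the basis; the other elements lie in finitely
    many slices on which [F i] is constant. *)
Lemma dickson (T I : eqType) (F : I -> T -> nat) (s : seq I) (A : set T) :
  exists2 B : seq T, {in B, forall b, A b} &
    forall a, A a -> exists2 b, b \in B & {in s, forall i, (F i b <= F i a)%N}.
Proof.
elim: s A => [|i s IHs] A.
  have [[a Aa]|nA] := pselect (exists a, A a); last first.
    by exists [::] => // a Aa; case: nA; exists a.
  exists [:: a] => [b|b Ab]; first by rewrite inE => /eqP->.
  by exists a => //; rewrite inE.
have [B BA Bmin] := IHs A.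
have [D DA Dmin] : exists2 D : seq T, {in D, forall b, A b} &
    forall a, A a -> (F i a < \max_(b <- B) F i b)%N ->
    exists2 b, b \in D & {in i :: s, forall j, (F j b <= F j a)%N}.
  elim: (\max_(b <- B) F i b)%N => [|k [D DA Dmin]]; first by exists [::].
  have [E EA Emin] := IHs [set a | A a /\ F i a = k].
  exists (D ++ E) => [b|a Aa].
    by rewrite mem_cat => /orP[/DA|/EA[]].
  rewrite ltnS leq_eqVlt => /orP[/eqP Fa|/(Dmin _ Aa)[b bD bmin]]; last first.
    by exists b; rewrite // mem_cat bD.
  have [//|b bE bmin] := Emin a.
  exists b => [|j]; first by rewrite mem_cat bE orbT.
  rewrite inE => /orP[/eqP->|/bmin//].
  by have [_ ->] := EA _ bE; rewrite Fa.
exists (B ++ D) => [b|a Aa]; first by rewrite mem_cat => /orP[/BA|/DA].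
have [/(Dmin _ Aa)[b bD bmin]|lea] := ltnP (F i a) (\max_(b <- B) F i b)%N.
  by exists b; rewrite // mem_cat bD orbT.
have [b bB bmin] := Bmin _ Aa.
exists b => [|j]; first by rewrite mem_cat bB.
rewrite inE => /orP[/eqP->|/bmin//].
by apply: leq_trans lea; rewrite (big_rem b) //= leq_maxl.
Qed.

(** * Ideals of monoid rings over the integers *)

(** For a submonoid [M] these are the elements of the monoid ring Z[M], kept inside the polynomial
    ring. *)
Definition supported n (M : set 'X_{1..n}) (f : {mpoly int[n]}) : Prop :=
  forall m, f@_m != 0 -> M m.

Record ideal_over n (M : set 'X_{1..n}) (I : set {mpoly int[n]}) : Prop :=
  IdealOver {
    ideal_supported : forall f, I f -> supported M f;
    ideal0 : I 0;
    idealB : forall f g, I f -> I g -> I (f - g);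
    idealX : forall m f, M m -> I f -> I ('X_[m] * f) }.

Section IdealOver.
Variables (n : nat) (M : set 'X_{1..n}) (I : set {mpoly int[n]}).
Hypothesis idI : ideal_over M I.

Lemma idealN f : I f -> I (- f).
Proof. by move=> If; rewrite -sub0r; apply: (idealB idI) => //; apply: (ideal0 idI). Qed.

Lemma idealD f g : I f -> I g -> I (f + g).
Proof. by move=> If /idealN Ig; rewrite -[g]opprK; apply: (idealB idI). Qed.

Lemma idealZ (c : int) f : I f -> I (c *: f).
Proof.
move=> If; have In k : I (f *+ k).
  by elim: k => [|k IHk]; [apply: (ideal0 idI) | rewrite mulrS; apply: idealD].
have -> : c *: f = f *~ c by rewrite -scaler_int intz.
by case: c => k; [apply: In | rewrite NegzE mulrNz; apply/idealN/In].
Qed.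

Lemma idealM f g : supported M f -> I g -> I (f * g).
Proof.
move=> Mf Ig; rewrite [f]mpolyE mulr_suml big_seq.
elim/big_ind: _ => [||m mf]; [exact: (ideal0 idI) | exact: idealD |].
rewrite -scalerAl; apply/idealZ/(idealX idI) => //.
by apply: Mf; rewrite -mcoeff_msupp.
Qed.

End IdealOver.

Section Supported.
Variables (n : nat) (M : set 'X_{1..n}).

Lemma supported0 : supported M 0.
Proof. by move=> m; rewrite mcoeff0 eqxx. Qed.

Lemma supportedX m : M m -> supported M 'X_[m].
Proof. by move=> Mm k; rewrite mcoeffX; have [<-|_] := eqVneq m k; rewrite ?eqxx. Qed.

Lemma supportedB f g : supported M f -> supported M g -> supported M (f - g).
Proof.
move=> Mf Mg m; rewrite mcoeffB.
have [f0|/Mf//] := eqVneq f@_m 0; have [g0|/Mg//] := eqVneq g@_m 0.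
by rewrite f0 g0 subrr eqxx.
Qed.

Lemma supportedD f g : supported M f -> supported M g -> supported M (f + g).
Proof.
move=> Mf Mg m; rewrite mcoeffD.
have [f0|/Mf//] := eqVneq f@_m 0; have [g0|/Mg//] := eqVneq g@_m 0.
by rewrite f0 g0 addr0 eqxx.
Qed.

Lemma supportedZ c f : supported M f -> supported M (c *: f).
Proof. by move=> Mf m; rewrite mcoeffZ mulf_eq0 negb_or => /andP[_ /Mf]. Qed.

Lemma supported_mulX m f : (forall k, M k -> M (m + k)%MM) ->
  supported M f -> supported M ('X_[m] * f).
Proof.
move=> MD Mf k; rewrite -mcoeff_msupp mulrC (perm_mem (msuppMX _ _)).
by case/mapP => j jf ->; apply/MD/Mf; rewrite -mcoeff_msupp.
Qed.

End Supported.

(* Division by the finitely many polynomials of I whose leading monomials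
   generate the leading monomials of I only inverts their leading coefficients;
   p is chosen to divide none of them. *)
Lemma ideal_over_no_inverse n (M : set 'X_{1..n}) (I : set {mpoly int[n]}) :
  (forall m k, M m -> M k -> (m <= k)%MM -> M (k - m)%MM) ->
  ideal_over M I -> (forall c : int, I c%:MP -> c = 0) ->
  exists2 p, prime p & forall f, supported M f -> ~ I (p%:Z *: f - 1).
Proof.
move=> MB idI I0.
have [B BI Bmin] := dickson (fun i (m : 'X_{1..n}) => m i) (enum 'I_n)
  [set m | exists f, [/\ I f, f != 0 & mlead f = m]].
have [D Dlead] : exists D : nat, forall b, b \in B ->
    exists f, [/\ I f, f != 0, mlead f = b & (`|mleadc f| <= D)%N].
  elim: {Bmin} B BI => [|b B IHB] BI; first by exists 0%N.
  have [|D Dlead] := IHB; first by move=> c cB; apply: BI; rewrite inE cB orbT.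
  have [|f [If f0 fb]] := BI b; first by rewrite inE eqxx.
  exists (maxn `|mleadc f| D) => c; rewrite inE => /orP[/eqP->|/Dlead].
    by exists f; rewrite leq_maxl.
  by case=> g [Ig g0 gc gD]; exists g; rewrite leq_max gD orbT.
have [p ltDp p_pr] := prime_above D.
exists p => // f Mf Ipf.
(* The constant 1 is generalized to [k] because each reduction of [f] multiplies it by a leading
   coefficient, which is coprime to [p]. *)
suff pdvd k : I (p%:Z *: f - k%:MP) -> (p %| `|k|)%N.
  by have := pdvd 1 Ipf; rewrite dvdn1 => /eqP p1; rewrite p1 in p_pr.
elim/(@mleadrect n int): f Mf {Ipf} k => f IHf Mf k Ipf.
have p0 : p%:Z != 0 by case: (p) p_pr.
have [lf0|lfN0] := eqVneq (mlead f) 0%MM.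
  have fC : f = (f@_0)%:MP.
    apply/mpolyP => m; rewrite mcoeffC; have [->|m0] := eqVneq m 0%MM.
      by rewrite mulr1.
    rewrite mulr0; apply: mcoeff_gt_mlead; rewrite lf0.
    by rewrite lt_def m0 lem_leo //; apply/mnm_lepP => i; rewrite mnm0E.
  have /I0/eqP : I (p%:Z * f@_0 - k)%:MP.
    by rewrite mpolyCB mpolyCM mul_mpolyC -fC.
  by rewrite subr_eq0 => /eqP <-; rewrite abszM dvdn_mulr.
have f0 : f != 0 by apply: contraNneq lfN0 => ->; rewrite mlead0.
have lf_gt0 : (0%MM < mlead f)%O.
  by rewrite lt_def lfN0 lem_leo //; apply/mnm_lepP => i; rewrite mnm0E.
set h := _ - _ in Ipf.
have lh : mlead h = mlead f.
  by rewrite mleadDl ?mleadZ // mleadN mleadC.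
have h0 : h != 0 by apply: contraNneq lfN0 => hE; rewrite -lh hE mlead0.
have [|b bB ble] := Bmin (mlead f); first by exists h.
have [g [Ig g0 lg gD]] := Dlead _ bB.
have {}ble : (mlead g <= mlead f)%MM.
  by rewrite lg; apply/mnm_lepP => i; apply: ble; rewrite mem_enum.
pose q := 'X_[mlead f - mlead g] * g.
have Iq : I q.
  apply: (idealX idI) => //; apply: MB => //.
    by apply: (ideal_supported idI Ig); rewrite mleadc_eq0.
  by apply: Mf; rewrite mleadc_eq0.
have X0 : 'X_[mlead f - mlead g] != 0 :> {mpoly int[n]}.
  by rewrite -mleadc_eq0 mleadXm mcoeffX eqxx.
have q0 : q != 0 by rewrite mulf_neq0.
have lq : mlead q = mlead f by rewrite mleadM // mleadXm submK.
have lcq : mleadc q = mleadc g by rewrite lq -{1}(submK ble) addmC /q mulrC addmC mcoeffMX.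
(* The leading terms cancel, and the relation for [f] passes to [f'] with [mleadc g * k] in place of
   [k]. *)
pose f' := mleadc g *: f - mleadc f *: q.
have If' : I (p%:Z *: f' - (mleadc g * k)%:MP).
  have -> : p%:Z *: f' - (mleadc g * k)%:MP =
      mleadc g *: h - (p%:Z * mleadc f) *: q.
    by rewrite /f' /h !scalerBr !scalerA mpolyCM mul_mpolyC [_ * p%:Z]mulrC addrAC.
  by apply: (idealB idI); apply: (idealZ idI).
have Mf' : supported M f'.
  apply: supportedB; apply: supportedZ => //.
  exact: (ideal_supported idI Iq).
have cop : coprime p `|mleadc g|.
  rewrite prime_coprime // gtnNdvd ?(leq_ltn_trans gD) //.
  by rewrite lt0n absz_eq0 mleadc_eq0.
rewrite -(Gauss_dvdr _ cop) -abszM.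
have [f'0|f'N0] := eqVneq f' 0.
  move: If'; rewrite f'0 scaler0 sub0r -mpolyCN => /I0/eqP.
  by rewrite oppr_eq0 => /eqP->.
apply: (IHf f') => //.
rewrite lt_def; apply/andP; split; last first.
  apply: le_trans (mleadB_le _ _) _.
  by rewrite leUx !(le_trans (mleadZ_le _ _)) ?lq.
apply: contraNneq f'N0 => lE; rewrite -mleadc_eq0 -lE.
by rewrite mcoeffB !mcoeffZ -{3}lq lcq mulrC subrr.
Qed.

(** * Maximal ideals and localization *)

(** If no [g] inverted ['X_[m]] modulo a maximal [J], the ideal J + Z[C] X^m would be larger and
    still proper. *)
Lemma maximal_ideal_over n (C : set 'X_{1..n}) (J0 : set {mpoly int[n]}) :
  C 0%MM -> (forall m k, C m -> C k -> C (m + k)%MM) ->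
  ideal_over C J0 -> ~ J0 1 ->
  exists J, [/\ J0 `<=` J, ideal_over C J, ~ J 1 &
    forall m, C m -> ~ J 'X_[m] ->
      exists2 g, supported C g & J (1 - g * 'X_[m])].
Proof.
move=> C0 CD idJ0 J01.
pose P K := K = set0 \/ [/\ J0 `<=` K, ideal_over C K & ~ K 1].
have [F FP Ftot|J [PJ Jmax]] := @Zorn_bigcup _ P.
  have [[K FK [f Kf]]|Fe] := pselect (exists2 K, F K & K !=set0); last first.
    left; rewrite -subset0 => f [K FK Kf]; apply: Fe.
    by exists K => //; exists f.
  have FI K' f' : F K' -> K' f' ->
      [/\ J0 `<=` K', ideal_over C K' & ~ K' 1].
    by move=> /FP[->|].
  have [J0K idK _] := FI _ _ FK Kf.
  right; split=> [g J0g||[K' FK' K'1]]; first by exists K => //; apply: J0K.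
    split=> [g [K' FK' K'g]||g h [K1 FK1 K1g] [K2 FK2 K2h]|m g Cm [K' FK' K'g]].
    - by have [_ id' _] := FI _ _ FK' K'g; exact: (ideal_supported id').
    - by exists K => //; exact: (ideal0 idK).
    - have [_ id1 _] := FI _ _ FK1 K1g; have [_ id2 _] := FI _ _ FK2 K2h.
      have [K12|K21] := Ftot _ _ FK1 FK2.
        by exists K2 => //; apply: (idealB id2) => //; apply: K12.
      by exists K1 => //; apply: (idealB id1) => //; apply: K21.
    - have [_ id' _] := FI _ _ FK' K'g.
      by exists K' => //; apply: (idealX id').
  by have [_ _ []] := FI _ _ FK' K'1.
have [J0J idJ J1] : [/\ J0 `<=` J, ideal_over C J & ~ J 1].
  case: PJ => // JE; have J00 := ideal0 idJ0.
  case: (Jmax J0); last by right; split.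
  by rewrite JE; split=> [|/(_ _ J00)].
exists J; split=> // m Cm Jm; apply: contrapT => nJ.
pose K := [set f | exists2 g, supported C g & J (f - g * 'X_[m])].
have JK : J `<=` K.
  by move=> f Jf; exists 0; [exact: supported0 | rewrite mul0r subr0].
have KX : K 'X_[m].
  exists 1; last by rewrite mul1r subrr; exact: (ideal0 idJ).
  by rewrite -mpolyX0; apply: supportedX.
apply: (Jmax K); first by split=> // KJ; apply/Jm/KJ.
right; split=> [f /J0J/JK//||[g Cg Jg]]; last by apply: nJ; exists g.
split.
- move=> f [g Cg Jg]; rewrite -[f](subrK (g * 'X_[m])).
  apply: supportedD; first exact: (ideal_supported idJ Jg).
  by rewrite mulrC; apply: supported_mulX => // k; apply: CD.
- exact/JK/(ideal0 idJ).
- move=> f h [g Cg Jg] [l Cl Jl]; exists (g - l); first exact: supportedB.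
  have -> : f - h - (g - l) * 'X_[m] = (f - g * 'X_[m]) - (h - l * 'X_[m]).
    by ring.
  exact: (idealB idJ).
- move=> k f Ck [g Cg Jg]; exists ('X_[k] * g).
    by apply: supported_mulX => // j; apply: CD.
  by rewrite -mulrA -mulrBr; apply: (idealX idJ).
Qed.

(* Modulo a maximal ideal J the monomials outside J form a monoid F, so that
   Z[F] localizes to the monoid ring of the natural exponents in F - F.  Being
   closed under truncated differences, that monoid satisfies Dickson's lemma,
   whereas C need not be finitely generated. *)
Lemma monoid_ring_no_inverses n (C : set 'X_{1..n}) (J0 : set {mpoly int[n]}) :
  C 0%MM -> (forall m k, C m -> C k -> C (m + k)%MM) ->
  ideal_over C J0 -> ~ J0 1 ->
  exists2 N, (1 < N)%N & forall f, supported C f -> ~ J0 (N%:Z *: f - 1).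
Proof.
move=> C0 CD idJ0 J01; apply: contrapT => inv.
have {}inv N : (1 < N)%N -> exists2 f, supported C f & J0 (N%:Z *: f - 1).
  move=> N1; apply: contrapT => nf; apply: inv; exists N => // f Cf Jf.
  by apply: nf; exists f.
have [J [J0J idJ J1 Jmax]] := maximal_ideal_over C0 CD idJ0 J01.
pose F := [set m | C m /\ ~ J 'X_[m]].
have F0 : F 0%MM by split=> //; rewrite mpolyX0.
have FD m k : F m -> F k -> F (m + k)%MM.
  move=> [Cm Jm] [Ck Jk]; split=> [|Jmk]; first exact: CD.
  (* An inverse of X^m modulo [J] turns X^(m+k) in [J] into X^k in [J]. *)
  have [g Cg Jg] := Jmax _ Cm Jm; apply: Jk.
  have -> : 'X_[k] = 'X_[k] * (1 - g * 'X_[m]) + g * 'X_[m + k] :> {mpoly int[n]}.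
    by rewrite mpolyXD; ring.
  by apply: (idealD idJ); [apply: (idealX idJ) | apply: (idealM idJ)].
pose M := [set m | exists a b, [/\ F a, F b & (m + a)%MM = b]].
have FM m : F m -> M m by move=> Fm; exists 0%MM, m; rewrite addm0.
have MD m k : M m -> M k -> M (m + k)%MM.
  move=> [a [b [Fa Fb mab]]] [c [d [Fc Fd kcd]]].
  exists (a + c)%MM, (b + d)%MM; split; [exact: FD | exact: FD |].
  by rewrite -mab -kcd -!addmA; congr mnm_add; rewrite !addmA [(k + a)%MM]addmC.
have MB m k : M m -> M k -> (m <= k)%MM -> M (k - m)%MM.
  move=> [a [b [Fa Fb mab]]] [c [d [Fc Fd kcd]]] lemk.
  exists (b + c)%MM, (a + d)%MM; split; [exact: FD | exact: FD |].
  by rewrite -mab -kcd !addmA submK // [(k + a)%MM]addmC.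
have XJ a : F a -> ~ J 'X_[a] by case.
(* The ideal that [J] generates once the monomials of [F] are inverted, restricted to Z[M]. *)
pose I := [set f | supported M f /\ exists2 a, F a & J ('X_[a] * f)].
have idI : ideal_over M I.
  split=> [f []//||f g [Mf [a Fa Jf]] [Mg [b Fb Jg]]|m f Mm [Mf [a Fa Jf]]].
  - split; first exact: supported0.
    by exists 0%MM => //; rewrite mulr0; exact: (ideal0 idJ).
  - split; first exact: supportedB.
    exists (a + b)%MM; first exact: FD.
    have -> : 'X_[a + b] * (f - g) = 'X_[b] * ('X_[a] * f) - 'X_[a] * ('X_[b] * g).
      by rewrite mpolyXD !mulrA ['X_[b] * _]mulrC mulrBr.
    by apply: (idealB idJ); apply: (idealX idJ) => //; case: Fa; case: Fb.
  - split; first by apply: supported_mulX => // k; apply: MD.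
    have [b [c [Fb Fc mbc]]] := Mm; exists (a + b)%MM; first exact: FD.
    have -> : 'X_[a + b] * ('X_[m] * f) = 'X_[c] * ('X_[a] * f).
      by rewrite -mbc !mulrA -!mpolyXD -addmA addmC [(b + m)%MM]addmC.
    by apply: (idealX idJ) => //; case: Fc.
have I0 (c : int) : I c%:MP -> c = 0.
  move=> [_ [a Fa Jc]]; apply: contra_notP (XJ _ Fa) => /eqP c0.
  have c0P : (0 < `|c|)%N by rewrite absz_gt0.
  (* The factor 2 is there because inverses are available only for N > 1, while [c] may be 1 or
     -1. *)
  have [|f Cf /J0J Jf] := inv (2 * `|c|)%N.
    by rewrite -(leq_pmul2l (isT : 0 < 2)%N) muln1 in c0P.
  have NE : (2 * `|c|)%:Z = (2 * Num.sg c) * c by rewrite PoszM abszE normrEsg mulrA.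
  have -> : 'X_[a] = (2 * Num.sg c) *: (f * ('X_[a] * c%:MP))
      - 'X_[a] * ((2 * `|c|)%:Z *: f - 1) :> {mpoly int[n]}.
    by rewrite NE -!mul_mpolyC mpolyCM; ring.
  apply: (idealB idJ).
    by apply/(idealZ idJ)/(idealM idJ).
  by apply: (idealX idJ) => //; case: Fa.
have [p p_pr no_inv] := ideal_over_no_inverse MB idI I0.
have [f Cf /J0J Jf] := inv _ (prime_gt1 p_pr).
(* Dropping the monomials that lie in [J] does not change [f] modulo [J], and brings it from Z[C]
   into Z[M]. *)
pose f' := \sum_(m <- msupp f | `[< F m >]) f@_m *: 'X_[m].
have Ff' : supported F f'.
  rewrite /f'; elim/big_ind: _ => [||m /asboolP Fm]; first exact: supported0.
    exact: supportedD.
  by apply: supportedZ; apply: supportedX.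
have Jff' : J (f - f').
  rewrite [f in f - _]mpolyE (bigID (fun m => `[< F m >])) /= -/f' addrAC subrr add0r.
  rewrite big_seq_cond; elim/big_ind: _ => [||m /andP[mf /asboolP Fm]].
  - exact: (ideal0 idJ).
  - exact: (idealD idJ).
  - apply: (idealZ idJ); apply: contrapT => Jm; apply: Fm; split=> //.
    by apply: Cf; rewrite -mcoeff_msupp.
apply: (no_inv f'); first by move=> m /Ff'/FM.
split.
  apply: supportedB; first by apply: supportedZ => m /Ff'/FM.
  by rewrite -mpolyX0; apply: supportedX; apply: FM.
exists 0%MM => //; rewrite mpolyX0 mul1r.
have -> : p%:Z *: f' - 1 = (p%:Z *: f - 1) - p%:Z *: (f - f').
  by rewrite -!mul_mpolyC; ring.
by apply: (idealB idJ) => //; apply: (idealZ idJ).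
Qed.

(** * Integer multiples and sums of monomials in a semiring *)

Section Multiples.
Variable S : semiring.
Implicit Types (x y : S) (k l : nat).

(* Indices are shifted by one because S need not have an additive identity:
   [multiple k x] is (k + 1) x. *)
Definition multiple k x : S := iter k (sadd x) x.

Lemma multipleD k l x :
  sadd (multiple k x) (multiple l x) = multiple (k + l).+1%N x.
Proof. by elim: k => //= k IHk; rewrite -saddA IHk. Qed.

Lemma multipleMl k x y : smul (multiple k x) y = multiple k (smul x y).
Proof. by elim: k => //= k IHk; rewrite smulDl IHk. Qed.

Lemma multiple_multiple k l x :
  multiple k (multiple l x) = multiple (k * l.+1 + l)%N x.
Proof.
elim: k => // k IHk.
have -> : (k.+1 * l.+1 + l = (l + (k * l.+1 + l)).+1)%N by lia.
by rewrite -multipleD -IHk.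
Qed.

End Multiples.

Section Monomials.
Variables (S : semiring) (one : S).
Hypothesis mul1s : left_id one (@smul S).

HB.instance Definition _ :=
  Monoid.isComLaw.Build S one (@smul S) (@smulA S) (@smulC S) mul1s.

Variables (n : nat) (x : 'I_n -> S).

Definition monomial (m : 'X_{1..n}) : S :=
  \big[@smul S/one]_(i < n) iter (m i) (smul (x i)) one.

Lemma monomial0 : monomial 0%MM = one.
Proof. by rewrite /monomial big1 // => i _; rewrite mnm0E. Qed.

Lemma monomialD m k : monomial (m + k)%MM = smul (monomial m) (monomial k).
Proof.
rewrite /monomial -big_split /=; apply: eq_bigr => i _; rewrite mnmDE.
elim: (m i) => [|j IHj]; first by rewrite mul1s.
by rewrite addSn /= IHj smulA.
Qed.

Lemma monomialU i : monomial U_(i)%MM = x i.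
Proof.
rewrite /monomial (bigD1 i) //= big1 => [|j jNi].
  by rewrite mnm1E eqxx /= !Monoid.mulm1.
by rewrite mnm1E eq_sym (negPf jNi).
Qed.

(* The empty sum, which S may lack, is None. *)
Definition monomial_sum (p : seq 'X_{1..n}) : option S :=
  \big[oAC (@saddA S) (@saddC S)/None]_(m <- p) Some (monomial m).

Lemma monomial_sum_cons m p u : monomial_sum p = Some u ->
  monomial_sum (m :: p) = Some (sadd (monomial m) u).
Proof. by rewrite /monomial_sum big_cons => ->; rewrite oACE. Qed.

Lemma monomial_sum1 m : monomial_sum [:: m] = Some (monomial m).
Proof. by rewrite /monomial_sum big_seq1. Qed.

Lemma monomial_sum_cat p q u v :
  monomial_sum p = Some u -> monomial_sum q = Some v ->
  monomial_sum (p ++ q) = Some (sadd u v).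
Proof. by rewrite /monomial_sum big_cat => -> ->; rewrite /= oACE. Qed.

Lemma monomial_sum_perm p q : perm_eq p q -> monomial_sum p = monomial_sum q.
Proof. exact: perm_big. Qed.

Variant monomial_sum_cons_spec m p v : Prop :=
  | MonomialSum1 of p = [::] & v = monomial m
  | MonomialSumCons u of monomial_sum p = Some u & v = sadd (monomial m) u.

Lemma monomial_sum_consP m p v :
  monomial_sum (m :: p) = Some v -> monomial_sum_cons_spec m p v.
Proof.
case: p => [|k p]; first by rewrite monomial_sum1 => -[<-]; left.
case Ep: (monomial_sum (k :: p)) => [u|].
  by rewrite (monomial_sum_cons m Ep) => -[<-]; right with u.
move: Ep; rewrite /monomial_sum big_cons.
by case: (\big[_/_]_(_ <- p) _) => [u|//]; rewrite oACE.
Qed.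

Lemma monomial_sum_shift m p u : monomial_sum p = Some u ->
  monomial_sum [seq (m + k)%MM | k <- p] = Some (smul (monomial m) u).
Proof.
elim: p u => [|k p IHp] u; first by rewrite /monomial_sum big_nil.
case/monomial_sum_consP => [-> ->|v /IHp Ep ->].
  by rewrite monomial_sum1 monomialD.
by rewrite /= (monomial_sum_cons _ Ep) monomialD smulDr.
Qed.

Lemma monomial_sum_mul p q u v :
  monomial_sum p = Some u -> monomial_sum q = Some v ->
  exists r, monomial_sum r = Some (smul u v).
Proof.
move=> Ep Eq; elim: p u Ep => [|m p IHp] u; first by rewrite /monomial_sum big_nil.
case/monomial_sum_consP => [_ ->|w /IHp[r Er] ->].
  by exists [seq (m + k)%MM | k <- q]; apply: monomial_sum_shift.
exists ([seq (m + k)%MM | k <- q] ++ r); rewrite smulDl.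
by apply: monomial_sum_cat Er; apply: monomial_sum_shift.
Qed.

Lemma monomial_sum_multiple k p u : monomial_sum p = Some u ->
  monomial_sum (iter k (cat p) p) = Some (multiple k u).
Proof.
by move=> Ep; elim: k => //= k IHk; apply: monomial_sum_cat.
Qed.

Lemma monomial_sum_mem m p u : m \in p -> monomial_sum p = Some u ->
  u = monomial m \/ exists c, u = sadd (monomial m) c.
Proof.
move=> /perm_to_rem/monomial_sum_perm-> /monomial_sum_consP[_ ->|c _ ->].
  by left.
by right; exists c.
Qed.

Lemma monomial_sum_generated (G : set S) :
  (forall g, G g -> exists i, x i = g) -> smallest (@subsemiring S) G = setT ->
  forall u, exists p, monomial_sum p = Some u.
Proof.
move=> Gx Gen u; have : setT u by []; rewrite -Gen.
apply: (@smallest_sub _ (@subsemiring S) _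
  [set v | exists p, monomial_sum p = Some v]); last first.
  move=> g /Gx[i <-].
  by exists [:: U_(i)%MM]; rewrite monomial_sum1 monomialU.
split.
- by exists one; exists [:: 0%MM]; rewrite monomial_sum1 monomial0.
- by move=> v w [p Ep] [q Eq]; exists (p ++ q); apply: monomial_sum_cat.
- by move=> v w [p Ep] [q Eq]; apply: monomial_sum_mul Ep Eq.
Qed.

(** * Bounded elements and their Grothendieck ring *)

(** The preorder behind this puts u below v when v = u + c for some c. *)
Definition bounded : set S :=
  [set u | exists c r, sadd u c = multiple r one].

Lemma bounded1 : bounded one.
Proof. by exists one, 1%N. Qed.

Lemma boundedD u v : bounded u -> bounded v -> bounded (sadd u v).
Proof.
move=> [c [r uc]] [d [s vd]]; exists (sadd c d), (r + s).+1%N.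
by rewrite -multipleD -uc -vd -!saddA; congr sadd; rewrite saddA [sadd v c]saddC -saddA.
Qed.

Lemma boundedM u v : bounded u -> bounded v -> bounded (smul u v).
Proof.
move=> [c [r uc]] [d [s vd]].
(* From (u + c)(v + d) = uv + ud + c(v + d); the index is (r + 1)(s + 1) - 1. *)
exists (sadd (smul u d) (smul c (sadd v d))), (r * s.+1 + s)%N.
rewrite -multiple_multiple -vd -[sadd v d in RHS]mul1s -multipleMl -uc.
by rewrite smulDl [smul u (sadd v d)]smulDr saddA.
Qed.

Definition bounded_exponents : set 'X_{1..n} := [set m | bounded (monomial m)].

Lemma bounded_exponents0 : bounded_exponents 0%MM.
Proof. by rewrite /bounded_exponents /= monomial0; apply: bounded1. Qed.

Lemma bounded_exponentsD m k :
  bounded_exponents m -> bounded_exponents k -> bounded_exponents (m + k)%MM.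
Proof. by rewrite /bounded_exponents /= monomialD; apply: boundedM. Qed.

Lemma bounded_monomial_sum p u : {in p, forall m, bounded_exponents m} ->
  monomial_sum p = Some u -> bounded u.
Proof.
elim: p u => [|m p IHp] u Bp; first by rewrite /monomial_sum big_nil.
have Bm : bounded (monomial m) by apply: Bp; rewrite inE eqxx.
case/monomial_sum_consP => [_ -> //|v Ep ->]; apply: boundedD => //.
by apply: IHp Ep => k kp; apply: Bp; rewrite inE kp orbT.
Qed.

Definition monomial_poly (p : seq 'X_{1..n}) : {mpoly int[n]} :=
  \sum_(m <- p) 'X_[m].

Lemma mcoeff_monomial_poly p m : (monomial_poly p)@_m = (count_mem m p)%:Z.
Proof.
rewrite /monomial_poly raddf_sum /=; elim: p => [|k p IHp]; first by rewrite big_nil.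
by rewrite big_cons IHp mcoeffX /= PoszD natz.
Qed.

Lemma monomial_poly_cat p q :
  monomial_poly (p ++ q) = monomial_poly p + monomial_poly q.
Proof. exact: big_cat. Qed.

Lemma monomial_poly_shift m p :
  monomial_poly [seq (m + k)%MM | k <- p] = 'X_[m] * monomial_poly p.
Proof.
rewrite /monomial_poly big_map mulr_sumr; apply: eq_bigr => k _.
by rewrite mpolyXD.
Qed.

Lemma supported_monomial_poly (M : set 'X_{1..n}) p :
  {in p, forall m, M m} -> supported M (monomial_poly p).
Proof.
move=> Mp m; rewrite mcoeff_monomial_poly eqz_nat -lt0n -has_count.
by case/hasP => k /Mp Mk /eqP <-.
Qed.

(* The relations of the Grothendieck ring of the semiring of bounded elements. *)
Definition bounded_relations : set {mpoly int[n]} :=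
  [set f | exists p q, [/\ {in p, forall m, bounded_exponents m},
     {in q, forall m, bounded_exponents m},
     exists2 u, monomial_sum p = Some u & monomial_sum q = Some u &
     f = monomial_poly p - monomial_poly q]].

Lemma bounded_relations_ideal : ideal_over bounded_exponents bounded_relations.
Proof.
split.
- move=> f [p [q [Bp Bq _ ->]]].
  by apply: supportedB; apply: supported_monomial_poly.
- have B0 : {in [:: 0%MM], forall m, bounded_exponents m}.
    by move=> m; rewrite inE => /eqP ->; apply: bounded_exponents0.
  exists [:: 0%MM], [:: 0%MM]; split; rewrite ?subrr //.
  by rewrite monomial_sum1; exists (monomial 0).
- have Bcat p q : {in p, forall m, bounded_exponents m} ->
      {in q, forall m, bounded_exponents m} ->
      {in p ++ q, forall m, bounded_exponents m}.
    by move=> Bp Bq m; rewrite mem_cat => /orP[/Bp|/Bq].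
  move=> f g [p [q [Bp Bq [u pu qu] ->]]] [r [s [Br Bs [v rv sv] ->]]].
  exists (p ++ s), (q ++ r); split; [exact: Bcat | exact: Bcat | |].
    by exists (sadd u v); apply: monomial_sum_cat.
  by rewrite !monomial_poly_cat; ring.
- have Bshift m p : bounded_exponents m ->
      {in p, forall k, bounded_exponents k} ->
      {in [seq (m + k)%MM | k <- p], forall k, bounded_exponents k}.
    by move=> Bm Bp j /mapP[k /Bp Bk ->]; apply: bounded_exponentsD.
  move=> m f Bm [p [q [Bp Bq [u pu qu] ->]]].
  exists [seq (m + k)%MM | k <- p], [seq (m + k)%MM | k <- q].
  split; [exact: Bshift | exact: Bshift | |].
    by exists (smul (monomial m) u); apply: monomial_sum_shift.
  by rewrite !monomial_poly_shift mulrBr.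
Qed.

(** Comparing coefficients, [p] is [q] with the exponent 0 added, so their common sum u satisfies 1
    + u = u. Adding an element that completes u to a positive integer carries this over to that
    integer. *)
Lemma bounded_relations1 : bounded_relations 1 ->
  exists r, sadd one (multiple r one) = multiple r one.
Proof.
move=> [p [q [_ Bq [u pu qu] pq]]].
have /monomial_sum_perm : perm_eq p (0%MM :: q).
  apply/allP => m _ /=; have := congr1 (mcoeff m) pq.
  rewrite mcoeff1 mcoeffB !mcoeff_monomial_poly => /eqP.
  by rewrite eq_sym subr_eq natz -PoszD eqz_nat [0%MM == m]eq_sym.
rewrite pu (monomial_sum_cons _ qu) monomial0 => -[uE].
have [c [r uc]] := bounded_monomial_sum Bq qu.
by exists r; rewrite -uc saddA -uE.
Qed.

(** By the index shift, (k + 2) u = 1. Hence each monomial of [p] is a summand of 1 and so bounded,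
    and k + 2 copies of [p] have the same sum as the single exponent 0. *)
Lemma bounded_relations_inverse k u p :
  multiple k.+1 u = one -> monomial_sum p = Some u ->
  supported bounded_exponents (monomial_poly p) /\
  bounded_relations (k.+2%:Z *: monomial_poly p - 1).
Proof.
move=> ku pu; have Bp : {in p, forall m, bounded_exponents m}.
  move=> m mp; have [uE|[c uE]] := monomial_sum_mem mp pu.
    by exists (multiple k u), 0%N; rewrite -uE.
  by exists (sadd c (multiple k u)), 0%N; rewrite saddA -uE.
split; first exact: supported_monomial_poly.
exists (iter k.+1 (cat p) p), [:: 0%MM]; split.
- by elim: k.+1 => //= j IHj m; rewrite mem_cat => /orP[/Bp|/IHj].
- by move=> m; rewrite inE => /eqP->; apply: bounded_exponents0.
- exists one; last by rewrite monomial_sum1 monomial0.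
  by rewrite -ku; apply: monomial_sum_multiple.
congr (_ - _); last by rewrite /monomial_poly big_seq1 mpolyX0.
rewrite -natz scaler_nat; elim: k.+1 => [|j IHj] //=.
by rewrite monomial_poly_cat -IHj mulrS.
Qed.

End Monomials.

(** Otherwise [bounded_relations1] makes the Grothendieck ring nonzero, although it contains the
    inverses of all positive integers, against [monoid_ring_no_inverses]. *)
Lemma finitely_generated_divisible (S : semiring) (one : S) :
  left_id one (@smul S) -> finitely_generated S ->
  (forall k, exists u, multiple k u = one) ->
  exists r, sadd one (multiple r one) = multiple r one.
Proof.
move=> mul1s [G /(@finite_seqP {classic S})[s Gs] Gen] divS.
pose x (i : 'I_(size s)) : S := tnth (in_tuple s) i.
apply: (@bounded_relations1 _ _ mul1s _ x); apply: contrapT => nrel1.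
have [[|[|k]] // _ nrel] := monoid_ring_no_inverses (bounded_exponents0 mul1s x)
  (@bounded_exponentsD _ _ mul1s _ x) (bounded_relations_ideal mul1s x) nrel1.
have [u ku] := divS k.+1.
have [|p pu] := @monomial_sum_generated _ _ mul1s _ x G _ Gen u.
  move=> g; rewrite Gs /= => gs.
  by have /tnthP[i ->] : g \in in_tuple s by []; exists i.
have [Bp rel] := bounded_relations_inverse mul1s ku pu.
exact: nrel Bp rel.
Qed.

(** * Parasemifields and semifields *)

Local Open Scope semiring_scope.

Lemma multiple_absorb (S : semiring) (x y : S) k :
  x + y = y -> multiple k x + y = y.
Proof. by move=> xy; elim: k => //= k IHk; rewrite -saddA IHk. Qed.

(** With R = [multiple k one], absorbing 1 repeatedly gives R + R = R; multiplication by [y] turns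
    this into 1 + 1 = 1. *)
Lemma absorbed_one_idempotent (S : semiring) (one y : S) k :
  left_id one (@smul S) -> one + multiple k one = multiple k one ->
  y * multiple k one = one -> additively_idempotent S.
Proof.
move=> mul1s abs inv x.
have one2 : one + one = one.
  by rewrite -{1 2 3}inv -smulDr multiple_absorb.
by rewrite -{1 2}[x]mul1s -smulDl one2 mul1s.
Qed.

Lemma parasemifield_idempotent (S : semiring) :
  parasemifield S -> finitely_generated S -> additively_idempotent S.
Proof.
move=> [_ _ [e _ eP]] fgS.
have mul1s : left_id e (@smul S) by move=> x; have [] := eP x I.
have inv x : exists y, y * x = e.
  by have [_ _ [y _ [yx _]]] := eP x I; exists y.
have [k|r abs] := finitely_generated_divisible mul1s fgS.
  by have [y ye] := inv (multiple k e); exists y;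
    rewrite -[y]mul1s -multipleMl smulC.
have [y yr] := inv (multiple r e).
exact: absorbed_one_idempotent mul1s abs yr.
Qed.

Lemma semifield_cases (S : semiring) :
  proper S -> semifield S -> finitely_generated S ->
  additively_constant S \/ additively_idempotent S.
Proof.
move=> properS [z zP [Mz _ [e ez eP]]] fgS.
have mul1s : left_id e (@smul S).
  move=> x; have [->|xz] := pselect (x = z); first by rewrite smulC zP.
  by have [] := eP x xz.
have inv x : x <> z -> exists y, y * x = e.
  by move=> xz; have [_ _ [y _ [yx _]]] := eP x xz; exists y.
have Mneq x y : x <> z -> y <> z -> x * y <> z by move=> *; apply: Mz.
(* If no positive multiple of [e] is [z], all of them are invertible and the argument for
   parasemifields applies. *)
have [[k kz]|nz] := pselect (exists k, multiple k e = z); last first.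
  right; have [k|r abs] := finitely_generated_divisible mul1s fgS.
    have [|y ye] := inv (multiple k e); first by move=> kz; apply: nz; exists k.
    by exists y; rewrite -[y]mul1s -multipleMl smulC.
  have [|y yr] := inv (multiple r e); first by move=> kz; apply: nz; exists r.
  exact: absorbed_one_idempotent mul1s abs yr.
left; have zz : z + z = z by rewrite -{1 2}(zP e) -smulDr zP.
(* A multiplicative idempotent is [z] or [e], so [z] is additively absorbing or additively
   neutral. *)
have tt : (e + z) * (e + z) = e + z.
  by rewrite smulDl zP smulDr mul1s mul1s -saddA zz.
have [tz|tz] := pselect (e + z = z); last first.
  have te : e + z = e.
    by have [y yt] := inv _ tz; have := congr1 (smul y) tt; rewrite smulA yt mul1s.
  have addz x : x + z = x by rewrite -[in LHS](zP x) -{1}[x]mul1s -smulDl te mul1s.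
  (* Now [z] is neutral and a positive multiple of [e] equals [z], which provides negatives: [S]
     would be a ring. *)
  case: properS; split=> //; first by move=> *; apply: saddA.
  exists z => // x _; split; rewrite ?addz //; first by rewrite saddC addz.
  case: k kz => [/ez//|k kz]; exists (multiple k e * x) => //.
  suff ex : x + multiple k e * x = z by rewrite saddC ex.
  by rewrite -{1}[x]mul1s -smulDl [_ + _]kz zP.
have addz x : x + z = z by rewrite -(zP x) -{1}[x]mul1s -smulDl tz.
have e2 : e + e = z.
  elim: k kz => [/ez//|[//|k] IHk kz].
  (* Were 2e and (k + 2)e both different from [z], so would be their product (2k + 4)e = (k + 1)e +
     (k + 3)e, but its last summand is [z]. *)
  apply: contrapT => e2; apply: (Mneq _ _ e2 (contra_not IHk e2)).
  rewrite smulDl mul1s multipleD.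
  have -> : (k.+1 + k.+1).+1%N = (k + k.+2).+1%N by lia.
  by rewrite -multipleD kz addz.
have ea a : e + a = z.
  (* The square of e + a contains the summand a + a = z, so it is [z]. *)
  apply: contrapT => eaz; apply: (Mneq _ _ eaz eaz).
  rewrite smulDr smulC mul1s -saddA [_ * a]smulDl mul1s [a + (a + _)]saddA.
  have -> : a + a = z by rewrite -{1 2}[a]mul1s -smulDl e2 zP.
  by rewrite [z + _]saddC !addz.
exists z => x y; have [->|xz] := pselect (x = z); first by rewrite saddC addz.
have [u ux] := inv _ xz.
have -> : y = x * (u * y) by rewrite smulA [x * u]smulC ux mul1s.
by rewrite -{1}[x]mul1s [e * x]smulC -smulDr ea smulC zP.
Qed.

(** * Ideal-simple semirings *)

(** An [e] with a e = a is neutral for every x in [A], because x is a multiple of a. *)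
Lemma divisible_group_on (S : semiring) (A : set S) : A !=set0 ->
  (forall x y, A x -> A y -> A (x * y)) ->
  (forall x y, A x -> A y -> exists2 s, A s & x * s = y) ->
  group_on (@smul S) A.
Proof.
move=> [a Aa] AM Adiv; split=> // [x y s _ _ _|]; first exact: smulA.
have [e Ae ae] := Adiv _ _ Aa Aa; exists e => // x Ax.
have ex : e * x = x.
  by have [s As <-] := Adiv _ _ Aa Ax; rewrite smulA [e * a]smulC ae.
have [y Ay xy] := Adiv _ _ Ax Ae.
by split; rewrite // 1?smulC //; exists y; rewrite // [y * x]smulC.
Qed.

(** When every product is [w], the ideals are exactly the additive subsemigroups containing [w], so
    any of these with a second element is all of [S]. *)
Lemma ideal_simple_null_mul (S : semiring) (w : S) :
  proper S -> ideal_simple S -> (forall x y : S, x * y = w) ->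
  additively_constant S \/ additively_idempotent S.
Proof.
move=> properS [[a1 [a2 a12]] simpleS] mulw.
have ww : w + w = w by rewrite -{1 2}(mulw w w) -smulDr mulw.
have idT (I : set S) x : I w -> (forall u v, I u -> I v -> I (u + v)) ->
    I x -> x <> w -> I = setT.
  move=> Iw ID Ix xw; apply: simpleS; last by exists x, w.
  by split=> // [|s u _]; [exists w | rewrite mulw].
have [idS|idw] := pselect (exists2 f : S, f <> w & f + f = f).
  right=> x; have [f fw ff] := idS.
  suff : [set u : S | u + u = u] x by [].
  rewrite (idT [set u : S | u + u = u] f) //= => u v uu vv.
  by rewrite saddA -[u + v + u]saddA [v + u]saddC saddA uu -saddA vv.
have {}idw f : f + f = f -> f = w.
  by move=> ff; apply: contrapT => fw; apply: idw; exists f.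
have w0 : (forall x, w + x = x) \/ (forall x, w + x = w).
  have [[s ws]|nw] := pselect (exists s, w + s <> w); last first.
    by right=> x; apply: contrapT => wx; apply: nw; exists x.
  left=> x; suff : [set u : S | w + u = u] x by [].
  rewrite (idT [set u : S | w + u = u] (w + s)) //= => [u v wu _|].
    by rewrite saddA wu.
  by rewrite saddA ww.
have dbl a : a <> w -> a + a = w \/ exists2 k, multiple k a = w & w + a = a.
  move=> aw; have [|a2w] := pselect (a + a = w); [by left | right].
  (* Since 2a differs from [w], [D] is everything and contains [a]. So a = (2k + 2)a, which makes
     (2k + 1)a idempotent and hence equal to [w]. *)
  pose D := [set u | u = w \/ exists k, u = multiple k (a + a)].
  have : D a.
    rewrite (idT D (a + a)) //=; [by left | | by right; exists 0%N].
    move=> u v [->|[k ->]] [->|[l ->]]; rewrite ?ww; first by left.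
    - by case: w0 => ->; [right; exists l | left].
    - by rewrite saddC; case: w0 => ->; [right; exists k | left].
    - by right; exists (k + l).+1%N; rewrite multipleD.
  case=> // -[k ak].
  have fa : multiple (k + k)%N a + a = a.
    rewrite saddC -[LHS]/(multiple (k + k).+1 a).
    have -> : (k + k).+1%N = (k * 2 + 1)%N by lia.
    by rewrite -multiple_multiple -ak.
  suff fw : multiple (k + k)%N a = w by exists (k + k)%N; rewrite -?fw.
  by apply: idw; case: (k + k)%N fa => //= j fa; rewrite saddA fa.
case: w0 => w0; last first.
  have dbl0 a : a <> w -> a + a = w.
    by move=> aw; case: (dbl a aw) => // -[k _ wa]; case: aw; rewrite -wa w0.
  have [a aw] : exists a, a <> w.
    have [a1w|a1w] := pselect (a1 = w); last by exists a1.
    by exists a2 => a2w; apply: a12; rewrite a1w a2w.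
  have wa x : x = w \/ x = a.
    pose D := [set u | u = w \/ u = a]; suff : D x by [].
    rewrite (idT D a) //=; [by left | | by right].
    move=> u v [->|->] [->|->]; left; rewrite ?(dbl0 a aw) ?w0 //.
    by rewrite saddC w0.
  left; exists w => x y.
  case: (wa x) => ->; first by rewrite w0.
  by case: (wa y) => ->; rewrite ?dbl0 // saddC w0.
case: properS; split=> //; first by move=> *; apply: saddA.
exists w => // x _; split; rewrite ?w0 //; first by rewrite saddC w0.
suff [y yx] : exists y, y + x = w by exists y; rewrite // [x + y]saddC.
have [->|xw] := pselect (x = w); first by exists w.
have [xx|[[|k] kw _]] := dbl x xw; first by exists x.
  by case: xw.
by exists (multiple k x); rewrite saddC.
Qed.

Lemma ideal_simple_cases (S : semiring) :
  proper S -> finitely_generated S -> ideal_simple S ->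
  additively_constant S \/ additively_idempotent S.
Proof.
move=> properS fgS simS; have [[a1 [a2 a12]] simpleS] := simS.
(* [K] collects the a for which the ideal aS is a single point; for all others aS = S. As [K] is
   empty, everything, or a point, [S] is a parasemifield, has constant multiplication, or is a
   semifield. *)
pose K := [set a : S | exists c, forall s, a * s = c].
have div a : ~ K a -> forall b, exists s, a * s = b.
  move=> Ka b; suff : [set u | exists s, a * s = u] b by [].
  rewrite (simpleS [set u | exists s, a * s = u]) //.
    split.
    - by exists (a * a), a.
    - by move=> _ _ [s <-] [t <-]; exists (s + t); rewrite smulDr.
    - by move=> t _ [s <-]; exists (t * s); rewrite smulA [a * t]smulC -smulA.
  have [s sa] : exists s, a * s <> a * a.
    apply: contrapT => nK; apply: Ka; exists (a * a) => s.
    by apply: contrapT => sa; apply: nK; exists s.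
  by exists (a * s), (a * a); split; [exists s | exists a |].
have [[w [c wc]]|K0] := pselect (K !=set0); last first.
  right; apply: parasemifield_idempotent => //.
  apply: divisible_group_on => // [|x y _ _]; first by exists a1.
  have [|s xs] := div x _ y; first by move=> Kx; apply: K0; exists x.
  by exists s.
have idK : ideal K.
  split; first by exists w, c.
  - by move=> x y [d xd] [d' yd]; exists (d + d') => s; rewrite smulDl xd yd.
  - by move=> s x [d xd]; exists d => t; rewrite [s * x]smulC -smulA xd.
have [KT|KT] := pselect (K = setT).
  apply: (@ideal_simple_null_mul _ c) => // x y.
  have [d xd] : K x by rewrite KT.
  by rewrite xd -(xd w) smulC wc.
have Kw : K w by exists c.
have Kone x : K x -> x = w.
  move=> Kx; apply: contrapT => xw; apply: KT; apply: simpleS => //.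
  by exists x, w.
have w0 : is_zero w.
  by move=> a; apply: Kone; have [_ _ KM] := idK; rewrite smulC; apply: KM.
have divw x y : x <> w -> exists s, x * s = y.
  by move=> xw; apply: div => /Kone.
apply: semifield_cases => //; exists w => //.
apply: divisible_group_on => [|x y xw yw /= xyw|x y xw yw].
- have [a1w|a1w] := pselect (a1 = w); last by exists a1.
  by exists a2 => a2w; apply: a12; rewrite a1w a2w.
(* With x u = x and y t = u, a product x y = w would give x = x y t = w. *)
- have [u xu] := divw x x xw; have [t yt] := divw y u yw.
  by apply: xw; rewrite -xu -yt smulA xyw w0.
- have [s xs] := divw x y xw; exists s => // sw.
  by apply: yw; rewrite -xs sw smulC w0.
Qed.

Theorem theorem1p2 :
  (forall S : semiring,
     parasemifield S -> finitely_generated S -> additively_idempotent S) /\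
  (forall S : semiring,
     proper S -> semifield S -> finitely_generated S ->
     additively_constant S \/ additively_idempotent S) /\
  (forall S : semiring,
     proper S -> finitely_generated S -> ideal_simple S ->
     additively_constant S \/ additively_idempotent S).
Proof.
split; first exact: parasemifield_idempotent.
by split; [exact: semifield_cases | exact: ideal_simple_cases].
Qed.
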